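(* Let $E$ be a finite set, $Z$ a random variable with values in $E$, and $\mathbf{X}=(X_i)_{i\in\mathbb{N}}$ a sequence of real valued random variables such that, for each $z\in E$, the conditional distribution of $\mathbf{X}$ given $Z=z$ is $P_z=\bigotimes_{i=1}^\infty P_z^i$, where $P_z^i$ is the $\mathcal{N}(\mu_i(z),\sigma_i^2(z))$-distribution with $\mu_i(z)\in\mathbb{R}$ and $\sigma_i(z)>0$ for all $i\in\mathbb{N}$ and $z\in E$. There is a measurable mapping $f:\mathbb{R}^{\mathbb{N}}\to E$ such that $Z=f(\mathbf{X})$ almost surely if and only if, for all $z,v\in E$ with $v\neq z$, either $$\sum_{i=1}^\infty\frac{(\mu_i(z)-\mu_i(v))^2}{\sigma_i^2(z)+\sigma_i^2(v)}=\infty\qquad\text{or}\qquad\sum_{i=1}^\infty\log\left(\frac{\sigma_i^2(z)+\sigma_i^2(v)}{2\sigma_i(z)\sigma_i(v)}\right)=\infty.$$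
   Context: $\mathbb{R}^{\mathbb{N}}$ carries the product $\sigma$-algebra. That $P_z$ is the conditional distribution of $\mathbf{X}$ given $Z=z$ means that $(P_z)_{z\in E}$ is a family of probability measures on $\mathbb{R}^{\mathbb{N}}$ with $\mathbb{P}(\mathbf{X}\in A,Z=z)=P_z(A)\,\mathbb{P}(Z=z)$ for all measurable $A\subseteq\mathbb{R}^{\mathbb{N}}$ and $z\in E$; in particular $X_1,X_2,\ldots$ are conditionally independent given $Z$. ''Either ... or'' is inclusive, and which of the two conditions holds may depend on the pair $(z,v)$.
   Formalization: The condition on the two series is required only for pairs z, v with P(Z=z)>0 and P(Z=v)>0; without this the ''only if'' fails, e.g. E={0,1}, Z=0 almost surely, P_0=P_1. *)

(* Defs.v *)
From HB Require Import structures.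
From mathcomp Require Import all_boot all_order all_algebra.
From mathcomp Require Import all_classical all_reals all_analysis.

Set Implicit Arguments.
Unset Strict Implicit.
Unset Printing Implicit Defensive.

Import Order.TTheory GRing.Theory Num.Theory.
Import numFieldNormedType.Exports.

Local Open Scope classical_set_scope.
Local Open Scope ring_scope.

Definition coordinate_sets (R : realType) : set (set (nat -> R)) :=
  \bigcup_(i in [set: nat])
    preimage_set_system [set: nat -> R] (fun x => x i) measurable.

Arguments coordinate_sets R : clear implicits.

(* The space of real sequences with the product sigma-algebra, i.e. the one
   generated by the coordinate projections; sequences are indexed from 0. *)
Notation Rseq R := (g_sigma_algebraType (coordinate_sets R)).

(* Q is the infinite product measure of the p i: the library has no
   construction of it, so it is characterized by its values on the measurable
   rectangles, which form a pi-system generating the product sigma-algebra. *)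
Definition is_infinite_product (R : realType)
    (p : nat -> probability (measurableTypeR R) R)
    (Q : probability (Rseq R) R) : Prop :=
  forall (n : nat) (B : nat -> set R), (forall i, measurable (B i)) ->
    (Q [set x : nat -> R | forall i, (i < n)%N -> B i (x i)] =
     \prod_(i < n) p i (B i))%E.

(* K z is unconstrained when P (Z = z) = 0. *)
Definition is_conditional_distribution d dS dE (R : realType)
    (Omega : measurableType d) (S : measurableType dS) (E : measurableType dE)
    (P : probability Omega R) (X : Omega -> S) (Z : Omega -> E)
    (K : E -> probability S R) : Prop :=
  forall (A : set S) (z : E), measurable A ->
    (P [set w | A (X w) /\ Z w = z] = K z A * P [set w | Z w = z])%E.

(* Main.v *)
Require Import Defs.
From HB Require Import structures.
From mathcomp Require Import all_boot all_order all_algebra.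
From mathcomp Require Import all_classical all_reals all_analysis.
From mathcomp Require Import measurable_realfun ring lra.

(** The theorem says that the law of [X] under [Z = z] and its law under
[Z = v] can be told apart with certainty exactly when they are mutually
singular, and that for infinite products of normal laws mutual singularity is
decided by the Hellinger affinity (Kakutani's dichotomy).

For two normal laws with densities [p] and [q], the function [sqrt (p q)] is
again a multiple of a normal density, so that the affinity [int sqrt (p q)] is
explicit: it equals [exp (- a / 4 - b / 2)] where [a] and [b] are the general
terms of the two series ([normal_pdf_mul], [sqrt_likelihood_ratio]).  Let [L n]
be the likelihood ratio of the first [n] coordinates.  The integral of
[sqrt (L n)] is the product of the first [n] affinities, that is [exp (- S n)]
with [S n] the partial sum of the exponents
([integral_sqrt_product_likelihood]).  As all terms are nonnegative, one of the
two series diverges if and only if [S] is unbounded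
([cumulative_exponent_unbounded]).

If [S] is unbounded, then the events [1 <= L n] have probability at most
[exp (- S n)] under one law, and their complements at most [exp (- S n)] under
the other; along a subsequence with summable bounds, the Borel-Cantelli lemma
yields a set that is null for the first law and conull for the second
([mutually_singular]).  As [E] is finite, the pairwise separating sets combine
into a measurable map recovering the label
([singular_family_classifier]).

If [S] is bounded, a separating set [A] cannot exist: it would be approximated
for both laws by a set [C] depending on finitely many coordinates only
([cylinder_approximation]), on which the second law has density [L n] with
respect to the first ([tilt_cylinder]).  But then [C] would be nearly null for
the first law and [~` C] for the second, and [int sqrt (L n)] would be small, a
contradiction with [exp (- S n)] being bounded below
([not_mutually_singular]).  A map [f] recovering the label provides such a
separating set, the preimage of [v]. *)

Set Implicit Arguments.
Unset Strict Implicit.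
Unset Printing Implicit Defensive.

Import Order.TTheory GRing.Theory Num.Theory.
Import numFieldNormedType.Exports.
Import HBNNSimple.

Local Open Scope classical_set_scope.
Local Open Scope ring_scope.

(** * Changing the measure under an integral *)

(** Both sides are additive in [f] and continuous along nondecreasing sequences,
so it suffices to compare them on indicators, where they agree by hypothesis.
Taking an image and a density in one step covers both uses: [phi] the identity,
which is integration against a density, and [phi] a coordinate projection,
which isolates one factor of a product measure. *)
Lemma integralT_image_density d1 d2 (X : measurableType d1)
    (Y : measurableType d2) (R : realType) (mu : {measure set X -> \bar R})
    (nu : {measure set Y -> \bar R}) (phi : X -> Y) (h : X -> R)
    (f : Y -> \bar R) :
  measurable_fun setT phi -> measurable_fun setT h -> (forall x, 0 <= h x) ->
  (forall S, measurable S ->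
    nu S = \int[mu]_(x in phi @^-1` S) (h x)%:E)%E ->
  measurable_fun setT f -> (forall y, 0 <= f y)%E ->
  (\int[nu]_y f y = \int[mu]_x (f (phi x) * (h x)%:E))%E.
Proof.
move=> mphi mh h0 nuE mf f0.
pose s := nnsfun_approx measurableT mf.
have mEh : measurable_fun setT (EFin \o h) by exact/measurable_EFinP.
have cvs y : (EFin \o s ^~ y) n @[n --> \oo] --> f y.
  by apply: cvg_nnsfun_approx.
have -> : (\int[nu]_y f y = limn (fun n => \int[nu]_y (s n y)%:E))%E.
  rewrite -monotone_convergence //=.
  - by apply: eq_integral => y _; apply/esym/cvg_lim => //; exact: cvs.
  - by move=> n; apply/measurable_EFinP; exact: measurable_funP.
  - by move=> n y _; rewrite lee_fin.
  - by move=> y _ a b ab; rewrite lee_fin; exact/lefP/nd_nnsfun_approx.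
have -> : (\int[mu]_x (f (phi x) * (h x)%:E) =
    limn (fun n => \int[mu]_x ((s n (phi x))%:E * (h x)%:E)))%E.
  rewrite -monotone_convergence //=.
  - apply: eq_integral => x _; apply/esym/cvg_lim => //.
    by apply: cvgeZr => //; exact: cvs.
  - move=> n; apply: emeasurable_funM => //.
    by apply/measurable_EFinP; apply: (measurableT_comp _ mphi).
  - by move=> n x _; rewrite mule_ge0 ?lee_fin.
  - by move=> x _ a b ab; rewrite lee_wpmul2r ?lee_fin//;
      exact/lefP/nd_nnsfun_approx.
congr (limn _); apply/funext => n.
have ind0 r y : (0 <= (r * \1_(s n @^-1` [set r]) y)%:E)%E.
  by rewrite EFinM nnfun_muleindic_ge0.
have mind r : measurable_fun setT (fun y => (r * \1_(s n @^-1` [set r]) y)%:E).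
  by apply/measurable_EFinP/measurable_funM.
transitivity (\sum_(r \in range (s n)) (r%:E * nu (s n @^-1` [set r])))%E.
  under eq_integral do rewrite fimfunE -fsumEFin//.
  rewrite ge0_integral_fsum//.
  apply: eq_fsbigr => r rs.
  under eq_integral do rewrite EFinM.
  by rewrite integralZl_indic_nnsfun// integral_indic// setIT.
under [in RHS]eq_integral.
  move=> x _; rewrite fimfunE -fsumEFin// ge0_mule_fsuml//; over.
rewrite ge0_integral_fsum//; last 2 first.
- move=> r; apply: emeasurable_funM => //.
  exact: (measurableT_comp (mind r) mphi).
- by move=> r x _; apply: mule_ge0; [exact: ind0|rewrite lee_fin].
apply: eq_fsbigr => r rs.
have [y _ ry] : range (s n) r by rewrite inE in rs.
have r0 : 0 <= r by rewrite -ry.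
rewrite nuE// integral_mkcond -ge0_integralZl_EFin//; first last.
- apply/(measurable_restrictT _ _).1 => //; last exact: measurable_funTS.
  by rewrite -[X in measurable X]setTI; exact: mphi.
- by move=> x _; rewrite patchE; case: ifPn => // _; rewrite lee_fin.
apply: eq_integral => x _; rewrite patchE EFinM -muleA; congr (_ * _)%E.
rewrite indicE.
have -> : (phi x \in s n @^-1` [set r]) = (x \in phi @^-1` (s n @^-1` [set r])).
  by apply/idP/idP; rewrite !inE.
by case: ifP => _; rewrite ?mul1e ?mul0e.
Qed.

Lemma integral_image_density d1 d2 (X : measurableType d1)
    (Y : measurableType d2) (R : realType) (mu : {measure set X -> \bar R})
    (nu : {measure set Y -> \bar R}) (phi : X -> Y) (h : X -> R)
    (f : Y -> \bar R) (D : set Y) :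
  measurable_fun setT phi -> measurable_fun setT h -> (forall x, 0 <= h x) ->
  (forall S, measurable S ->
    nu S = \int[mu]_(x in phi @^-1` S) (h x)%:E)%E ->
  measurable_fun setT f -> (forall y, 0 <= f y)%E -> measurable D ->
  (\int[nu]_(y in D) f y =
   \int[mu]_(x in phi @^-1` D) (f (phi x) * (h x)%:E))%E.
Proof.
move=> mphi mh h0 nuE mf f0 mD.
rewrite integral_mkcond.
rewrite (integralT_image_density (mu := mu) (phi := phi) (h := h))//;
  last 2 first.
- by apply/(measurable_restrictT _ _).1 => //; exact: measurable_funTS.
- by move=> y; rewrite patchE; case: ifP.
rewrite [RHS]integral_mkcond; apply: eq_integral => x _; rewrite !patchE.
rewrite (_ : (x \in phi @^-1` D) = (phi x \in D)).
  by case: ifP => // _; rewrite mul0e.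
by apply/idP/idP; rewrite !inE.
Qed.

(** The proofs of measurability and nonnegativity are arguments so that the
measure structure below can be inferred from the term. *)
Definition density d (T : measurableType d) (R : realType)
    (mu : {measure set T -> \bar R}) (h : T -> R)
    of measurable_fun setT h & (forall x, 0 <= h x) : set T -> \bar R :=
  fun A => (\int[mu]_(x in A) (h x)%:E)%E.

Section density_measure.
Context d (T : measurableType d) (R : realType) (mu : {measure set T -> \bar R})
  (h : T -> R) (mh : measurable_fun setT h) (h0 : forall x, 0 <= h x).

Let dens0 : density mu mh h0 set0 = 0%E.
Proof. by rewrite /density integral_set0. Qed.

Let dens_ge0 A : (0 <= density mu mh h0 A)%E.
Proof. by apply: integral_ge0 => x _; rewrite lee_fin. Qed.

Let dens_additive : semi_sigma_additive (density mu mh h0).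
Proof.
move=> F mF tF mUF; rewrite /density ge0_integral_bigcup//.
- apply: is_cvg_ereal_nneg_natsum_cond => n _ _.
  by apply: integral_ge0 => x _; rewrite lee_fin.
- by apply: measurable_funTS; exact/measurable_EFinP.
- by move=> x _; rewrite lee_fin.
Qed.

HB.instance Definition _ := isMeasure.Build _ _ _ (density mu mh h0)
  dens0 dens_ge0 dens_additive.

End density_measure.

(** * Tilting finitely many coordinates of a product measure *)

Definition rectangle (R : realType) (N : nat) (B : nat -> set R) :
    set (Rseq R) :=
  [set x : nat -> R | forall i, (i < N)%N -> B i (x i)].

Lemma measurable_coordinate (R : realType) (i : nat) :
  measurable_fun [set: Rseq R] (fun x : Rseq R => (x : nat -> R) i).
Proof.
move=> _ S mS; apply: sub_sigma_algebra; exists i => //.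
by exists S.
Qed.

Lemma rectangleS (R : realType) N (B : nat -> set R) :
  rectangle N.+1 B =
  rectangle N B `&` (fun x : Rseq R => (x : nat -> R) N) @^-1` (B N).
Proof.
apply/seteqP; split=> x /=.
- by move=> xB; split=> [i iN|]; apply: xB => //; exact: ltnW.
- move=> [xB xN] i; rewrite ltnS leq_eqVlt => /orP[/eqP ->//|].
  exact: xB.
Qed.

Lemma measurable_rectangle (R : realType) N (B : nat -> set R) :
  (forall i, measurable (B i)) -> measurable (rectangle N B).
Proof.
move=> mB; elim: N => [|N IH].
  rewrite (_ : rectangle 0 B = setT)//; exact/seteqP.
rewrite rectangleS; apply: measurableI => //.
by rewrite -[X in measurable X]setTI; exact: measurable_coordinate.
Qed.

Lemma integral_setI_indicator d (T : measurableType d) (R : realType)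
    (mu : {measure set T -> \bar R}) (A B : set T) (h : T -> R) :
  (\int[mu]_(x in A) (h x * \1_B x)%:E = \int[mu]_(x in A `&` B) (h x)%:E)%E.
Proof.
rewrite integral_mkcondr; apply: eq_integral => x _.
by rewrite patchE indicE; case: ifP => _; rewrite ?mulr1 ?mulr0.
Qed.

(** If [r i] is the density of [p' i] with respect to [p i], this is the density
of the product measure whose first [n] factors are changed from [p] to [p']. *)
Definition tilt (R : realType) (r : nat -> R -> R) (n : nat) (x : Rseq R) : R :=
  \prod_(i < n) r i ((x : nat -> R) i).

Lemma measurable_tilt (R : realType) (r : nat -> R -> R) n :
  (forall i, measurable_fun setT (r i)) -> measurable_fun setT (tilt r n).
Proof.
move=> mr; apply: measurable_prod => i _.
exact: (measurableT_comp (mr i) (@measurable_coordinate R i)).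
Qed.

Lemma tilt_ge0 (R : realType) (r : nat -> R -> R) n x :
  (forall i y, 0 <= r i y) -> 0 <= tilt r n x.
Proof. by move=> r0; apply: prodr_ge0. Qed.

(** Replacing the factors one at a time.  With the other coordinates confined
to a rectangle and weighted by the tilt of the first [n] of them, coordinate [n]
is distributed as a multiple of [p n], by the induction hypothesis applied to
all rectangles with arbitrary side [n]; the density [r n] can therefore be
integrated against [p n] alone.  Since the rectangles of that step have a side
in a coordinate that is not tilted yet, the number [N] of sides may exceed the
number [n] of tilted coordinates. *)
Lemma integral_tilt_rectangle (R : realType)
    (p p' : nat -> probability (measurableTypeR R) R) (r : nat -> R -> R)
    (Q : probability (Rseq R) R) :
  is_infinite_product p Q ->
  (forall i, measurable_fun setT (r i)) -> (forall i y, 0 <= r i y) ->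
  (forall i B, measurable B -> p' i B = \int[p i]_(y in B) (r i y)%:E)%E ->
  forall n N (B : nat -> set R), (n <= N)%N -> (forall i, measurable (B i)) ->
  (\int[Q]_(x in rectangle N B) (tilt r n x)%:E =
   \prod_(i < N) (if (i < n)%N then p' i (B i) else p i (B i)))%E.
Proof.
move=> QE mr r0 p'E; elim=> [|n IH] N B nN mB.
  under eq_integral do rewrite /tilt big_ord0.
  by rewrite integral_cst ?mul1e; [exact: QE|exact: measurable_rectangle].
pose F i S := if (i < n)%N then p' i S else p i S.
pose n' := Ordinal nN.
pose c := (\prod_(i < N | i != n') F i (B i))%E.
have F_fin i S : measurable S -> F i S \is a fin_num.
  by move=> mS; rewrite /F; case: ifP => _; exact: fin_num_measure.
have c_fin : c \is a fin_num.
  apply: (big_ind (fun y => y \is a fin_num)) => //.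
  - by move=> x y; exact: fin_numM.
  - by move=> i _; apply: F_fin; exact: mB.
have c0 : (0 <= c)%E.
  by apply: prode_ge0 => i _; rewrite /F; case: ifP.
have c0' : 0 <= fine c by exact: fine_ge0.
(* The weight of the rectangle as a function of its side [n]. *)
pose nu := mscale (NngNum c0') (p n).
pose Bn S i := if i == n then S else B i.
have mBn S i : measurable S -> measurable (Bn S i).
  by rewrite /Bn; case: ifP.
pose Rest := rectangle N (Bn setT).
have mRest : measurable Rest.
  by apply: measurable_rectangle => i; exact: mBn.
pose h x := tilt r n x * \1_Rest x.
have rectE S : rectangle N (Bn S) =
    (fun x : Rseq R => (x : nat -> R) n) @^-1` S `&` Rest.
  apply/seteqP; split=> x /=.
  - move=> xB; split; first by have := xB _ nN; rewrite /Bn eqxx.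
    by move=> i iN; have := xB _ iN; rewrite /Bn; case: ifP.
  - move=> [xS xB] i iN; have := xB _ iN; rewrite /Bn.
    by case: ifP => // /eqP ->.
have nuE S : measurable S ->
    (nu S = \int[Q]_(x in (fun x : Rseq R => (x : nat -> R) n) @^-1` S)
      (h x)%:E)%E.
  move=> mS; rewrite integral_setI_indicator -rectE IH//; last 2 first.
  - exact: ltnW.
  - by move=> i; exact: mBn.
  rewrite (bigD1 n')//= ltnn {1}/Bn eqxx /nu /mscale /= fineK// muleC.
  congr (_ * _)%E; apply: eq_bigr => i /negPf ni.
  by rewrite /Bn (_ : (i == n :> nat) = false).
have BE : B = Bn (B n) by apply/funext => i; rewrite /Bn; case: eqP => // ->.
rewrite [in LHS]BE rectE.
transitivity (\int[nu]_(y in B n) (r n y)%:E)%E.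
  rewrite (@integral_image_density _ _ _ (measurableTypeR R) _ Q nu
      (fun x : Rseq R => (x : nat -> R) n) h)//.
  - rewrite -integral_setI_indicator; apply: eq_integral => x _.
    by rewrite /h /tilt big_ord_recr/= -EFinM mulrCA mulrA.
  - exact: measurable_coordinate.
  - by apply: measurable_funM => //; exact: measurable_tilt.
  - by move=> x; rewrite mulr_ge0// tilt_ge0.
  - by apply/measurable_EFinP; exact: mr.
  - by move=> y; rewrite lee_fin.
  - exact: mB.
transitivity ((fine c)%:E * \int[p n]_(y in B n) (r n y)%:E)%E.
  apply: (ge0_integral_mscale (p n) (mB n) (NngNum c0')) => //.
  - by apply: measurable_funTS; apply/measurable_EFinP; exact: mr.
  - by move=> y _; rewrite lee_fin.
rewrite -p'E; last exact: mB.
rewrite fineK// [RHS](bigD1 n')//= leqnn muleC; congr (_ * _)%E.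
apply: eq_bigr => i /negPf ni; rewrite /F ltnS (leq_eqVlt i n).
by rewrite (_ : (i == n :> nat) = false).
Qed.

(** * Approximation by cylinder sets *)

(** The sets that can be approximated form a sigma-algebra: finite unions are
immediate, and a countable union is approximated by its finite parts because
the measure is finite. *)
Lemma algebra_approximation d (T : measurableType d) (R : realType)
    (mu : {measure set T -> \bar R}) (G : set (set T)) :
  (mu setT < +oo)%E -> @measurable _ T = <<s G >> ->
  G set0 -> setC_closed G -> setU_closed G ->
  forall A : set T, measurable A -> forall e : R, 0 < e ->
  exists2 C, G C & (mu (A `+` C) < e%:E)%E.
Proof.
move=> muoo mG G0 GC GU.
have GM (C : set T) : G C -> measurable C.
  by move=> GC0; rewrite mG; exact: sub_sigma_algebra.
have mY (A C : set T) : measurable A -> measurable C -> measurable (A `+` C).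
  by move=> mA mC; apply: measurableU; exact: measurableD.
pose H := [set A : set T | measurable A /\ forall e : R, 0 < e ->
  exists2 C, G C & (mu (A `+` C) < e%:E)%E].
have HU : setU_closed H.
  move=> A B [mA HA] [mB HB]; split; first exact: measurableU.
  move=> e e0; have e20 : 0 < e / 2 by rewrite divr_gt0.
  have [C GCC AC] := HA _ e20; have [D GD BD] := HB _ e20.
  exists (C `|` D); first exact: GU.
  have mAC : measurable (A `+` C) by apply: mY => //; exact: GM.
  have mBD : measurable (B `+` D) by apply: mY => //; exact: GM.
  rewrite [e]splitr EFinD; apply: le_lt_trans (lteD AC BD).
  apply: le_trans (measureU2 mu mAC mBD).
  apply: le_measure; rewrite ?inE.
  - by apply: mY; apply: measurableU => //; exact: GM.
  - exact: measurableU.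
  - by move=> x /=; tauto.
suff : sigma_algebra setT H.
  move=> sH A mA; have : <<s G >> A by rewrite -mG.
  move=> /(_ H)[]//; split => // B GB; split; first exact: GM.
  move=> e e0; exists B => //.
  by rewrite setYK measure0 lte_fin.
split.
- split => // e e0; exists set0 => //.
  by rewrite setYK measure0 lte_fin.
- move=> A [mA HA]; rewrite setTD; split; first exact: measurableC.
  move=> e e0; have [C GCC AC] := HA _ e0.
  exists (~` C); first exact: GC.
  rewrite (_ : _ `+` _ = A `+` C)//.
  apply/seteqP; split => x /=; have [] := pselect (A x);
    have [] := pselect (C x); tauto.
move=> F HF; have mF n : measurable (F n) by have [] := HF n.
have mUF : measurable (\bigcup_k F k) by exact: bigcupT_measurable.
split => // e e0; have e20 : 0 < e / 2 by rewrite divr_gt0.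
pose U n := \big[setU/set0]_(i < n) F i.
have HUn n : H (U n).
  rewrite /U; elim: n => [|n IH].
    rewrite big_ord0; split => // e' e'0; exists set0 => //.
    by rewrite setYK measure0 lte_fin.
  by rewrite big_ord_recr; exact: HU.
have mU n : measurable (U n) by have [] := HUn n.
pose D n := (\bigcup_k F k) `\` U n.
have mD n : measurable (D n) by exact: measurableD.
have : mu (D n) @[n --> \oo] --> mu (\bigcap_n D n).
  apply: nonincreasing_cvg_mu => //.
  - by apply: le_lt_trans muoo; apply: le_measure; rewrite ?inE.
  - exact: bigcapT_measurable.
  - move=> m n mn; apply/subsetPset => x [Fx nU]; split => // Ux; apply: nU.
    exact: (subset_bigsetU mn).
have -> : \bigcap_n D n = set0.
  apply/seteqP; split => // x DD; have [k _ Fk] := (DD 0%N I).1.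
  by have [_] := DD k.+1 I; apply; rewrite /U big_ord_recr; right.
rewrite measure0 => cvD.
have [n nD] : exists n, (mu (D n) < (e / 2)%:E)%E.
  apply/not_existsP => Dn.
  have : ((e / 2)%:E <= limn (mu \o D))%E.
    apply: lime_ge; first by apply/cvg_ex; exists 0%E.
    by apply: nearW => n; rewrite leNgt; apply/negP; exact: Dn.
  by rewrite (cvg_lim _ cvD)// lee_fin leNgt e20.
have [_ /(_ _ e20)[C GCC UC]] := HUn n.
exists C => //; rewrite [e]splitr EFinD; apply: le_lt_trans (lteD nD UC).
have mYUC : measurable (U n `+` C) by apply: mY => //; exact: GM.
apply: le_trans (measureU2 mu (mD n) mYUC).
apply: le_measure; rewrite ?inE.
- by apply: mY => //; exact: GM.
- exact: measurableU.
- move=> x /=; rewrite /D /=.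
  have UF : U n x -> (\bigcup_k F k) x by exact: bigsetU_bigcup.
  by have [] := pselect (U n x); tauto.
Qed.

Definition rectangles (R : realType) (n : nat) : set (set (Rseq R)) :=
  [set A | exists2 B : nat -> set R,
    (forall i, measurable (B i)) & A = rectangle n B].

Arguments rectangles R n : clear implicits.

(** The events that depend on the first [n] coordinates only. *)
Definition cylinders (R : realType) (n : nat) : set (set (Rseq R)) :=
  <<s rectangles R n >>.

Arguments cylinders R n : clear implicits.

Lemma cylinder_measurable (R : realType) n (A : set (Rseq R)) :
  cylinders R n A -> measurable A.
Proof.
apply: smallest_sub; first exact: sigma_algebra_measurable.
by move=> _ [B mB ->]; exact: measurable_rectangle.
Qed.

Lemma cylinders_mono (R : realType) m n (A : set (Rseq R)) : (m <= n)%N ->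
  cylinders R m A -> cylinders R n A.
Proof.
move=> mn; apply: sub_sigma_algebra2 => _ [B mB ->].
exists (fun i => if (i < m)%N then B i else setT).
  by move=> i; case: ifP.
apply/seteqP; split => x xB i /= => [_|im].
  by case: ifP => // im; exact: xB.
by have := xB i (leq_trans im mn); rewrite im.
Qed.

Lemma cylinder_approximation (R : realType)
    (mu : {measure set (Rseq R) -> \bar R}) (A : set (Rseq R)) (e : R) :
  (mu setT < +oo)%E -> measurable A -> 0 < e ->
  exists n, exists2 C, cylinders R n C & (mu (A `+` C) < e%:E)%E.
Proof.
move=> muoo mA e0.
pose G := [set C | exists n, cylinders R n C].
suff [C [n nC] AC] : exists2 C, G C & (mu (A `+` C) < e%:E)%E.
  by exists n, C.
apply: (@algebra_approximation _ _ _ mu G) => //.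
- apply/seteqP; split.
  + apply: smallest_sub; first exact: smallest_sigma_algebra.
    move=> _ [i _ [B mB <-]]; apply: sub_sigma_algebra; exists i.+1.
    apply: sub_sigma_algebra; exists (fun j => if j == i then B else setT).
      by move=> j; case: ifP.
    apply/seteqP; split => x /=.
      by move=> [_ xB] j _; case: ifP => // /eqP ->.
    by move=> /(_ i (ltnSn i)); rewrite eqxx.
  + apply: smallest_sub; first exact: sigma_algebra_measurable.
    by move=> C [n nC]; exact: cylinder_measurable nC.
- by exists 0%N; exact: sigma_algebra0.
- by move=> C [n nC]; exists n; rewrite -setTD; exact: sigma_algebraCD.
- move=> C D [m mC] [n nD]; exists (maxn m n).
  rewrite -bigcup2E; apply: sigma_algebra_bigcup => -[|[|k]] /=.
  + exact: cylinders_mono (leq_maxl _ _) mC.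
  + exact: cylinders_mono (leq_maxr _ _) nD.
  + exact: sigma_algebra0.
Qed.

(** Two finite measures that agree on the rectangles with [n] sides, which are
stable under intersection, agree on the sigma-algebra that they generate. *)
Lemma tilt_cylinder (R : realType)
    (p p' : nat -> probability (measurableTypeR R) R) (r : nat -> R -> R)
    (Q Q' : probability (Rseq R) R) :
  is_infinite_product p Q -> is_infinite_product p' Q' ->
  (forall i, measurable_fun setT (r i)) -> (forall i y, 0 <= r i y) ->
  (forall i B, measurable B -> p' i B = \int[p i]_(y in B) (r i y)%:E)%E ->
  forall n C, cylinders R n C ->
  (Q' C = \int[Q]_(x in C) (tilt r n x)%:E)%E.
Proof.
move=> QE Q'E mr r0 p'E n C nC.
pose h0 (x : Rseq R) : 0 <= tilt r n x := tilt_ge0 n x r0.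
rewrite -[RHS]/(density Q (measurable_tilt n mr) h0 C).
apply: (g_sigma_algebra_measure_unique (rectangles R n) _ (fun _ => setT)) nC.
- by move=> _ [B mB ->]; exact: measurable_rectangle.
- move=> _; exists (fun=> setT) => //.
  exact/seteqP.
- by apply/seteqP; split => // x _; exists 0%N.
- move=> _ _ [A mA ->] [B mB ->]; exists (fun i => A i `&` B i).
    by move=> i; exact: measurableI.
  apply/seteqP; split => x /=.
    by move=> [xA xB] i ni; split; [exact: xA|exact: xB].
  by move=> xAB; split => i /xAB[].
- move=> _ [B mB ->]; rewrite /density.
  rewrite [RHS](integral_tilt_rectangle QE mr r0 p'E)//.
  rewrite [LHS]Q'E//; apply: eq_bigr => i _.
  by rewrite ltn_ord.
- by move=> _; rewrite (le_lt_trans (probability_le1 _ _))// ltry.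
Qed.

(** * Hellinger affinity of normal laws *)

Definition likelihood_ratio (R : realType) (m s m' s' : R) (y : R) : R :=
  normal_pdf m' s' y / normal_pdf m s y.

(** The opposite of the logarithm of the Hellinger affinity of two normal
laws. *)
Definition hellinger_exponent (R : realType) (m s m' s' : R) : R :=
  (m - m') ^+ 2 / (s ^+ 2 + s' ^+ 2) / 4
  + ln ((s ^+ 2 + s' ^+ 2) / (2 * s * s')) / 2.

(** Parameters of the normal law whose density is proportional to the geometric
mean of the densities of the laws with parameters [(m, s)] and [(m', s')]. *)
Definition mid_mean (R : realType) (m s m' s' : R) : R :=
  (m * s' ^+ 2 + m' * s ^+ 2) / (s ^+ 2 + s' ^+ 2).

Definition mid_deviation (R : realType) (s s' : R) : R :=
  s * s' * Num.sqrt (2 / (s ^+ 2 + s' ^+ 2)).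

Lemma normal_pdf_gt0 (R : realType) (m s y : R) : 0 < s -> 0 < normal_pdf m s y.
Proof.
move=> s0; rewrite normal_pdfE ?gt_eqF// mulr_gt0 ?expR_gt0//.
by rewrite normal_peak_gt0// gt_eqF.
Qed.

Lemma mid_deviation_gt0 (R : realType) (s s' : R) : 0 < s -> 0 < s' ->
  0 < mid_deviation s s'.
Proof.
by move=> s0 s'0; rewrite !mulr_gt0// sqrtr_gt0 divr_gt0// addr_gt0// exprn_gt0.
Qed.

Lemma normal_peakE (R : realType) (s : R) : 0 < s ->
  normal_peak s = (s * Num.sqrt (pi *+ 2))^-1.
Proof.
move=> s0; rewrite /normal_peak -mulrnAr sqrtrM ?sqr_ge0//.
by rewrite sqrtr_sqr gtr0_norm.
Qed.

(** Completing the square in the exponent gives the mean and the deviation on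
the right; what is left over is twice the exponent of the affinity. *)
Lemma normal_pdf_mul (R : realType) (m s m' s' y : R) : 0 < s -> 0 < s' ->
  normal_pdf m s y * normal_pdf m' s' y =
  (expR (- hellinger_exponent m s m' s') *
   normal_pdf (mid_mean m s m' s') (mid_deviation s s') y) ^+ 2.
Proof.
move=> s0 s'0; have d0 := mid_deviation_gt0 s0 s'0.
have S0 : 0 < s ^+ 2 + s' ^+ 2 by rewrite addr_gt0// exprn_gt0.
have d2 : mid_deviation s s' ^+ 2 = s ^+ 2 * s' ^+ 2 * 2 / (s ^+ 2 + s' ^+ 2).
  by rewrite !exprMn sqr_sqrtr ?mulrA// divr_ge0// ltW.
have t0 : 0 < Num.sqrt (pi *+ 2 : R) by rewrite sqrtr_gt0 pmulrn_lgt0// pi_gt0.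
rewrite !normal_pdfE ?gt_eqF// !normal_peakE// /normal_fun d2 !exprMn.
rewrite -!expRM_natl.
set t := Num.sqrt (pi *+ 2) in t0 *.
have q0 : 0 < (s ^+ 2 + s' ^+ 2) / (2 * s * s') by rewrite divr_gt0// !mulr_gt0.
rewrite mulrACA -expRD exprVn exprMn d2.
rewrite mulrCA -expRD.
have -> : 2 * - hellinger_exponent m s m' s' = 
  - ln ((s ^+ 2 + s' ^+ 2) / (2 * s * s')) 
  - (m - m') ^+ 2 / (s ^+ 2 + s' ^+ 2) / 2.
  by rewrite /hellinger_exponent; field; rewrite gt_eqF.
rewrite -addrA [in RHS]expRD [in RHS]expRN lnK ?posrE// mulrA; congr (_ * _).
  by field; rewrite !gt_eqF.
congr expR; rewrite /mid_mean; field.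
by rewrite !gt_eqF.
Qed.

(** The root of a likelihood ratio is thus again a likelihood ratio up to a
constant, and its integral needs no computation beyond the mass of a normal
law. *)
Lemma sqrt_likelihood_ratio (R : realType) (m s m' s' y : R) :
  0 < s -> 0 < s' ->
  Num.sqrt (likelihood_ratio m s m' s' y) =
  expR (- hellinger_exponent m s m' s') *
  likelihood_ratio m s (mid_mean m s m' s') (mid_deviation s s') y.
Proof.
move=> s0 s'0; have p0 := normal_pdf_gt0 m y s0.
have d0 := mid_deviation_gt0 s0 s'0.
rewrite /likelihood_ratio mulrA -[RHS]ger0_norm; last first.
  by rewrite !mulr_ge0 ?expR_ge0 ?normal_pdf_ge0 ?invr_ge0 ?normal_pdf_ge0.
rewrite -sqrtr_sqr exprMn -normal_pdf_mul//; congr Num.sqrt.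
by field; rewrite gt_eqF.
Qed.

Lemma likelihood_ratio_gt0 (R : realType) (m s m' s' y : R) :
  0 < s -> 0 < s' -> 0 < likelihood_ratio m s m' s' y.
Proof. by move=> s0 s'0; rewrite divr_gt0// normal_pdf_gt0. Qed.

Lemma measurable_likelihood_ratio (R : realType) (m s m' s' : R) :
  0 < s -> measurable_fun setT (likelihood_ratio m s m' s').
Proof.
move=> s0; apply: measurable_funM; first exact: measurable_normal_pdf.
apply: continuous_measurable_fun => y; apply: cvgV.
  by rewrite gt_eqF// normal_pdf_gt0.
by apply: continuous_normal_pdf; rewrite gt_eqF.
Qed.

Lemma normal_prob_likelihood_ratio (R : realType) (m s m' s' : R) (B : set R) :
  0 < s -> 0 < s' -> measurable B ->
  (normal_prob m' s' B =
   \int[normal_prob m s]_(y in B) (likelihood_ratio m s m' s' y)%:E)%E.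
Proof.
move=> s0 s'0 mB.
rewrite (@integral_image_density _ _ (measurableTypeR R) (measurableTypeR R) _
  lebesgue_measure (normal_prob m s) id (normal_pdf m s))//=.
- apply: eq_integral => y _; rewrite -EFinM divfK//.
  by rewrite gt_eqF// normal_pdf_gt0.
- exact: measurable_normal_pdf.
- by move=> y; exact: normal_pdf_ge0.
- by apply/measurable_EFinP; exact: measurable_likelihood_ratio.
- by move=> y; rewrite lee_fin ltW// likelihood_ratio_gt0.
Qed.

(** * Affinity of products of normal laws *)

(** The opposite of the logarithm of the affinity of the laws of the first [n]
coordinates. *)
Definition cumulative_exponent (R : realType) (m s m' s' : nat -> R) (n : nat)
    : R :=
  \sum_(i < n) hellinger_exponent (m i) (s i) (m' i) (s' i).

Definition product_likelihood (R : realType) (m s m' s' : nat -> R) (n : nat)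
    : Rseq R -> R :=
  tilt (fun i => likelihood_ratio (m i) (s i) (m' i) (s' i)) n.

Lemma product_likelihood_gt0 (R : realType) (m s m' s' : nat -> R) n x :
  (forall i, 0 < s i) -> (forall i, 0 < s' i) ->
  0 < product_likelihood m s m' s' n x.
Proof.
by move=> s0 s'0; apply: prodr_gt0 => i _; exact: likelihood_ratio_gt0.
Qed.

Lemma measurable_product_likelihood (R : realType) (m s m' s' : nat -> R) n :
  (forall i, 0 < s i) ->
  measurable_fun setT (product_likelihood m s m' s' n).
Proof.
by move=> s0; apply: measurable_tilt => i; exact: measurable_likelihood_ratio.
Qed.

Lemma sqrt_product_likelihood (R : realType) (m s m' s' : nat -> R) n x :
  (forall i, 0 < s i) -> (forall i, 0 < s' i) ->
  Num.sqrt (product_likelihood m s m' s' n x) =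
  expR (- cumulative_exponent m s m' s' n) *
  product_likelihood m s (fun i => mid_mean (m i) (s i) (m' i) (s' i))
    (fun i => mid_deviation (s i) (s' i)) n x.
Proof.
move=> s0 s'0; rewrite /product_likelihood /tilt /cumulative_exponent.
elim: n => [|n IH]; first by rewrite !big_ord0 oppr0 expR0 sqrtr1 mulr1.
rewrite !big_ord_recr/= sqrtrM; last first.
  by apply: prodr_ge0 => i _; rewrite ltW// likelihood_ratio_gt0.
by rewrite IH sqrt_likelihood_ratio// mulrACA -expRD -opprD.
Qed.

Lemma measurable_sqrt_product_likelihood (R : realType)
    (m s m' s' : nat -> R) n :
  (forall i, 0 < s i) -> (forall i, 0 < s' i) ->
  measurable_fun setT (fun x => Num.sqrt (product_likelihood m s m' s' n x)).
Proof.
move=> s0 s'0.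
apply: (eq_measurable_fun (fun x : Rseq R =>
    expR (- cumulative_exponent m s m' s' n) *
    product_likelihood m s (fun i => mid_mean (m i) (s i) (m' i) (s' i))
      (fun i => mid_deviation (s i) (s' i)) n x)).
  by move=> x _; rewrite sqrt_product_likelihood.
apply: measurable_funM; first exact: measurable_cst.
exact: measurable_product_likelihood.
Qed.

(** Up to the constant, the integrand is the density of a product of normal
laws, which has mass one. *)
Lemma integral_sqrt_product_likelihood (R : realType) (m s m' s' : nat -> R)
    (Q : probability (Rseq R) R) n :
  (forall i, 0 < s i) -> (forall i, 0 < s' i) ->
  is_infinite_product (fun i => normal_prob (m i) (s i)) Q ->
  (\int[Q]_x (Num.sqrt (product_likelihood m s m' s' n x))%:E =
   (expR (- cumulative_exponent m s m' s' n))%:E)%E.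
Proof.
move=> s0 s'0 QE.
pose c i := mid_mean (m i) (s i) (m' i) (s' i).
pose d i := mid_deviation (s i) (s' i).
have d0 i : 0 < d i by exact: mid_deviation_gt0.
under eq_integral do rewrite sqrt_product_likelihood// EFinM.
rewrite ge0_integralZl_EFin ?expR_ge0//; last 2 first.
- by move=> x _; rewrite lee_fin ltW// product_likelihood_gt0.
- by apply/measurable_EFinP; exact: measurable_product_likelihood.
rewrite [X in (_ * X)%E](_ : _ = 1%E) ?mule1//.
rewrite [LHS](_ : _ = (\int[Q]_(x in rectangle n (fun=> setT))
  (product_likelihood m s c d n x)%:E)%E);
  last by congr (integral _ _ _); exact/esym/seteqP.
rewrite (@integral_tilt_rectangle _ _ (fun i => normal_prob (c i) (d i)) _ _ QE)//.
- by apply: big1 => i _; case: ifP => _; exact: probability_setT.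
- by move=> i; exact: measurable_likelihood_ratio.
- by move=> i y; rewrite ltW// likelihood_ratio_gt0.
- by move=> i B mB; exact: normal_prob_likelihood_ratio.
Qed.

(** The indicator of the event is at most the root of the likelihood ratio. *)
Lemma likelihood_ge1_bound (R : realType) (m s m' s' : nat -> R)
    (Q : probability (Rseq R) R) n :
  (forall i, 0 < s i) -> (forall i, 0 < s' i) ->
  is_infinite_product (fun i => normal_prob (m i) (s i)) Q ->
  (Q [set x | 1 <= product_likelihood m s m' s' n x]%R
   <= (expR (- cumulative_exponent m s m' s' n))%:E)%E.
Proof.
move=> s0 s'0 QE; rewrite -(integral_sqrt_product_likelihood m' n s0 s'0 QE).
set A := [set x | _].
have mA : measurable A.
  rewrite -[A]setTI; apply: measurable_fun_le => //.
  exact: measurable_product_likelihood.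
rewrite -[A]setIT -integral_indic//; apply: ge0_le_integral => //.
- by apply/measurable_EFinP; exact: measurable_indic.
- by apply/measurable_EFinP; exact: measurable_sqrt_product_likelihood.
- move=> x _; rewrite lee_fin indicE; case: (boolP (x \in A)) => [|_].
    by rewrite inE => L1; rewrite -[leLHS]sqrtr1 ler_wsqrtr.
  exact: sqrtr_ge0.
Qed.

Lemma hellinger_exponentC (R : realType) (m s m' s' : R) :
  hellinger_exponent m s m' s' = hellinger_exponent m' s' m s.
Proof.
rewrite /hellinger_exponent [s' ^+ 2 + s ^+ 2]addrC.
by rewrite -[(m' - m) ^+ 2]sqrrN opprB [2 * s' * s]mulrAC.
Qed.

Lemma product_likelihoodV (R : realType) (m s m' s' : nat -> R) n x :
  product_likelihood m' s' m s n x = (product_likelihood m s m' s' n x)^-1.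
Proof.
rewrite /product_likelihood /tilt -prodfV; apply: eq_bigr => i _.
by rewrite /likelihood_ratio invf_div.
Qed.

(** The previous bound with the two laws exchanged, which inverts the
likelihood ratio and leaves the affinity unchanged. *)
Lemma likelihood_lt1_bound (R : realType) (m s m' s' : nat -> R)
    (Q : probability (Rseq R) R) n :
  (forall i, 0 < s i) -> (forall i, 0 < s' i) ->
  is_infinite_product (fun i => normal_prob (m' i) (s' i)) Q ->
  (Q (~` [set x | 1 <= product_likelihood m s m' s' n x]%R)
   <= (expR (- cumulative_exponent m s m' s' n))%:E)%E.
Proof.
move=> s0 s'0 QE.
have -> : cumulative_exponent m s m' s' n = cumulative_exponent m' s' m s n.
  by apply: eq_bigr => i _; exact: hellinger_exponentC.
apply: le_trans (likelihood_ge1_bound m n s'0 s0 QE).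
have mL (m1 s1 m2 s2 : nat -> R) : (forall i, 0 < s1 i) ->
    measurable [set x | 1 <= product_likelihood m1 s1 m2 s2 n x].
  move=> s10; rewrite -[X in measurable X]setTI; apply: measurable_fun_le => //.
  exact: measurable_product_likelihood.
apply: le_measure; rewrite ?inE; [by apply: measurableC; exact: mL|exact: mL|].
move=> x /=; rewrite product_likelihoodV => /negP; rewrite -ltNge => L1.
by move: L1; rewrite invf_lt1 ?product_likelihood_gt0// => /ltW.
Qed.

(** * The dichotomy for products of normal laws *)

(** Along a subsequence for which the affinity is at most [2^-k], the limit
superior of the events [1 <= L] is null for [Q] by the Borel-Cantelli lemma, and
its complement is null for [Q'] because it is the union of the intersections of
the tails of the complements, each of probability at most [2^-k] for all large
[k]. *)
Lemma mutually_singular (R : realType) (m s m' s' : nat -> R)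
    (Q Q' : probability (Rseq R) R) :
  (forall i, 0 < s i) -> (forall i, 0 < s' i) ->
  is_infinite_product (fun i => normal_prob (m i) (s i)) Q ->
  is_infinite_product (fun i => normal_prob (m' i) (s' i)) Q' ->
  (forall M, exists n, M <= cumulative_exponent m s m' s' n) ->
  exists A, [/\ measurable A, Q A = 0%E & Q' (~` A) = 0%E].
Proof.
move=> s0 s'0 QE Q'E unbounded.
(* This bound on the exponent makes the affinity at most [2^-(k+1)]. *)
have [u uP] := choice (fun k => unbounded (- ln ((2^-1 : R) ^+ k.+1))).
have half k : expR (- cumulative_exponent m s m' s' (u k)) <= 2^-1 ^+ k.+1.
  rewrite -[leRHS]lnK ?posrE ?exprn_gt0// ler_expR lerNl.
  exact: uP.
pose F k : set (Rseq R) :=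
  [set x | 1 <= product_likelihood m s m' s' (u k) x].
have mF k : measurable (F k).
  rewrite -[X in measurable X]setTI; apply: measurable_fun_le => //.
  exact: measurable_product_likelihood.
have FQ k : (Q (F k) <= ((2^-1) ^+ k.+1)%:E)%E.
  apply: le_trans (likelihood_ge1_bound m' (u k) s0 s'0 QE) _.
  by rewrite lee_fin.
have FQ' k : (Q' (~` F k) <= ((2^-1) ^+ k.+1)%:E)%E.
  apply: le_trans (likelihood_lt1_bound m (u k) s0 s'0 Q'E) _.
  by rewrite lee_fin.
exists (lim_sup_set F); split.
- by apply: bigcapT_measurable => n; exact: bigcup_measurable.
- apply: lim_sup_set_cvg0 => //.
  apply: (@le_lt_trans _ _ (\sum_(n <oo) (1 / (2 ^ (n + 1))%:R)%:E)%E).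
    apply: lee_nneseries => // n _; apply: le_trans (FQ n) _.
    by rewrite lee_fin div1r addn1 natrX exprVn.
  by rewrite (cvg_lim _ (@cvg_geometric_eseries_half R 1 0))// ltry.
- rewrite /lim_sup_set setC_bigcap; apply/negligibleP.
    apply: bigcup_measurable => n _; apply: measurableC.
    exact: bigcup_measurable.
  apply: negligible_bigcup => n.
  have mn : measurable (~` (\bigcup_(j >= n) F j)).
    by apply: measurableC; exact: bigcup_measurable.
  apply/negligibleP => //; apply/eqP; rewrite eq_le measure_ge0 andbT.
  apply/lee_addgt0Pr => e e0; rewrite add0e.
  have [k nk ke] : exists2 k, (n <= k)%N & (2^-1 : R) ^+ k.+1 <= e.
    exists (maxn n (Num.truncn e^-1)); first exact: leq_maxl.
    rewrite exprVn -[leRHS]invrK lef_pV2 ?posrE ?exprn_gt0 ?invr_gt0//.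
    apply: (le_trans (ltW (truncnS_gt _))); rewrite -natrX ler_nat.
    apply: (leq_trans _ (ltnW (ltn_expl _ (ltnSn 1)))).
    by rewrite ltnS leq_maxr.
  apply: (@le_trans _ _ (Q' (~` F k))).
    apply: le_measure; rewrite ?inE//; first exact: measurableC.
    by apply: subsetC => x Fx; exists k.
  by apply: le_trans (FQ' k) _; rewrite lee_fin.
Qed.

(** The inequality of arithmetic and geometric means
[sqrt L <= (w + L / w) / 2], integrated over a set that depends on [n]
coordinates, where [L] is the density of [Q'] with respect to [Q].  The weight
[w] allows one of the two probabilities to be small while the other is not. *)
Lemma integral_sqrt_cylinder (R : realType) (m s m' s' : nat -> R)
    (Q Q' : probability (Rseq R) R) n (C : set (Rseq R)) (w : R) :
  (forall i, 0 < s i) -> (forall i, 0 < s' i) ->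
  is_infinite_product (fun i => normal_prob (m i) (s i)) Q ->
  is_infinite_product (fun i => normal_prob (m' i) (s' i)) Q' ->
  cylinders R n C -> 0 < w ->
  (\int[Q]_(x in C) (Num.sqrt (product_likelihood m s m' s' n x))%:E <=
   (w / 2)%:E * Q C + (w^-1 / 2)%:E * Q' C)%E.
Proof.
move=> s0 s'0 QE Q'E nC w0; have mC := cylinder_measurable nC.
have L0 x : 0 < product_likelihood m s m' s' n x.
  exact: product_likelihood_gt0.
have mL : measurable_fun C (EFin \o product_likelihood m s m' s' n).
  apply: measurable_funTS; apply/measurable_EFinP.
  exact: measurable_product_likelihood.
have w20 : 0 <= w / 2 by rewrite divr_ge0// ltW.
have wV20 : 0 <= w^-1 / 2 by rewrite divr_ge0// invr_ge0 ltW.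
have -> : (Q' C = \int[Q]_(x in C) (product_likelihood m s m' s' n x)%:E)%E.
  apply: (tilt_cylinder QE Q'E _ _ _ nC).
  - by move=> i; exact: measurable_likelihood_ratio.
  - by move=> i y; rewrite ltW// likelihood_ratio_gt0.
  - by move=> i B mB; exact: normal_prob_likelihood_ratio.
rewrite -integral_cst// -ge0_integralZl_EFin//; last first.
  by move=> x _; rewrite lee_fin ltW.
rewrite -ge0_integralD//; first last.
- exact: measurable_funeM.
- by move=> x _; rewrite -EFinM lee_fin mulr_ge0// ltW.
apply: ge0_le_integral => //.
- apply: measurable_funTS; apply/measurable_EFinP.
  exact: measurable_sqrt_product_likelihood.
- by apply: emeasurable_funD => //; exact: measurable_funeM.
- move=> x _; rewrite -EFinM -EFinD lee_fin.
  set L := product_likelihood _ _ _ _ _ _.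
  have := L0 x; rewrite -/L => L0'.
  have := sqr_sqrtr (ltW L0'); set q := Num.sqrt L => qL.
  have : 0 <= (q - w) ^+ 2 / w by rewrite divr_ge0 ?sqr_ge0// ltW.
  have -> : (q - w) ^+ 2 / w = L / w - 2 * q + w.
    by rewrite -qL; field; rewrite gt_eqF.
  lra.
Qed.

(** Let [c = exp (- M)], a lower bound of all affinities, and let [C] be a
cylinder set with [Q C] and [Q' (~` C)] at most [c^2 / 8].  Weighting by [2 / c]
on [C] and by [c / 2] on its complement bounds the affinity by [3 c / 4]. *)
Lemma not_mutually_singular (R : realType) (m s m' s' : nat -> R)
    (Q Q' : probability (Rseq R) R) (M : R) (A : set (Rseq R)) :
  (forall i, 0 < s i) -> (forall i, 0 < s' i) ->
  is_infinite_product (fun i => normal_prob (m i) (s i)) Q ->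
  is_infinite_product (fun i => normal_prob (m' i) (s' i)) Q' ->
  (forall n, cumulative_exponent m s m' s' n <= M) ->
  measurable A -> Q A = 0%E -> Q' (~` A) <> 0%E.
Proof.
move=> s0 s'0 QE Q'E SM mA QA0 Q'A0.
pose c := expR (- M); have c0 : 0 < c by exact: expR_gt0.
pose e := c ^+ 2 / 8; have e0 : 0 < e by rewrite divr_gt0// exprn_gt0.
have [|n [C nC AC]] := @cylinder_approximation _ (measure_add Q Q') A e _ mA e0.
  suff QQ : (Q setT + Q' setT < +oo)%E.
    exact: (eq_ind_r (fun y => (y < +oo)%E) QQ (measure_addE Q Q' setT)).
  by rewrite !probability_setT ltry.
have mC := cylinder_measurable nC.
have mAC : measurable (A `+` C) by apply: measurableU; exact: measurableD.
have {}AC : (Q (A `+` C) + Q' (A `+` C) < e%:E)%E.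
  exact: (eq_ind _ (fun y => (y < e%:E)%E) AC _ (measure_addE Q Q' _)).
have QC : (Q C <= e%:E)%E.
  apply: le_trans (ltW AC); apply: (@le_trans _ _ (Q (A `+` C))).
    rewrite -[leRHS]add0e -QA0; apply: le_trans (measureU2 _ mA mAC).
    apply: le_measure; rewrite ?inE//; first exact: measurableU.
    by move=> x /= Cx; have [] := pselect (A x); tauto.
  by rewrite leeDl.
have Q'C : (Q' (~` C) <= e%:E)%E.
  apply: le_trans (ltW AC); apply: (@le_trans _ _ (Q' (A `+` C))).
    rewrite -[leRHS]add0e -Q'A0.
    apply: le_trans (measureU2 _ (measurableC mA) mAC).
    apply: le_measure; rewrite ?inE//; first exact: measurableC.
    - by apply: measurableU => //; exact: measurableC.
    - by move=> x /= Cx; have [] := pselect (A x); tauto.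
  by rewrite leeDr.
have := integral_sqrt_product_likelihood m' n s0 s'0 QE.
rewrite -(setvU C) ge0_integral_setU//; last 3 first.
- exact: measurableC.
- apply: measurable_funTS; apply/measurable_EFinP.
  exact: measurable_sqrt_product_likelihood.
- by apply/disj_setPS; rewrite setICl.
have nCC : cylinders R n (~` C) by rewrite -setTD; exact: sigma_algebraCD.
(* The weight [2 / c] multiplies the small [Q C], and the weight [c / 2] on the
   complement divides the small [Q' (~` C)]. *)
have t0 : 0 < 2 / c by rewrite divr_gt0.
have tV0 : 0 < c / 2 by rewrite divr_gt0.
have := integral_sqrt_cylinder s0 s'0 QE Q'E nC t0.
have := integral_sqrt_cylinder s0 s'0 QE Q'E nCC tV0.
set I1 := (\int[_]_(x in ~` C) _)%E; set I2 := (\int[_]_(x in C) _)%E.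
move=> I1le I2le I12.
have I1b : (I1 <= (c / 2 / 2 + (c / 2)^-1 / 2 * e)%:E)%E.
  apply: (le_trans I1le); rewrite EFinD; apply: leeD.
    rewrite -[leRHS]mule1; apply: lee_wpmul2l.
      by rewrite lee_fin !divr_ge0// ltW.
    by apply: probability_le1; exact: measurableC.
  by rewrite [leRHS]EFinM lee_wpmul2l// lee_fin divr_ge0 ?invr_ge0// ltW.
have I2b : (I2 <= (2 / c / 2 * e + (2 / c)^-1 / 2)%:E)%E.
  apply: (le_trans I2le); rewrite EFinD; apply: leeD.
    by rewrite [leRHS]EFinM lee_wpmul2l// lee_fin divr_ge0// ltW.
  rewrite -[leRHS]mule1; apply: lee_wpmul2l; last exact: probability_le1.
  by rewrite lee_fin divr_ge0// invr_ge0 ltW.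
have := leeD I1b I2b; rewrite I12 -EFinD lee_fin => cle.
have : c <= expR (- cumulative_exponent m s m' s' n).
  by rewrite ler_expR lerN2.
move=> /le_trans /(_ cle).
have -> : c / 2 / 2 + (c / 2)^-1 / 2 * e + (2 / c / 2 * e + (2 / c)^-1 / 2)
    = 3 / 4 * c.
  by rewrite /e; field; rewrite gt_eqF.
lra.
Qed.

(** * Divergence of the two series *)

(** A form of divergence without limits, suited to compare the two series with
the partial sums of the exponents. *)
Lemma nneseries_unbounded (R : realType) (a : nat -> R) :
  (forall i, 0 <= a i) ->
  (\sum_(0 <= i <oo) (a i)%:E = +oo)%E <->
  (forall M, exists n, M <= \sum_(i < n) a i).
Proof.
move=> a0; split=> [aoo M|aM].
- apply/not_existsP => nM; move/eqP: aoo; apply/negP; rewrite lt_eqF//.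
  apply: (@le_lt_trans _ _ M%:E); last exact: ltry.
  apply: lime_le; first by apply: is_cvg_nneseries => i _ _; rewrite lee_fin.
  apply: nearW => n; rewrite sumEFin lee_fin big_mkord leNgt.
  by apply/negP => /ltW; exact: nM.
- have l0 : (0 <= \sum_(0 <= i <oo) (a i)%:E)%E.
    by apply: nneseries_ge0 => i _ _; rewrite lee_fin.
  have le n : ((\sum_(i < n) a i)%:E <= \sum_(0 <= i <oo) (a i)%:E)%E.
    rewrite -(big_mkord xpredT a) -sumEFin; apply: nneseries_lim_ge => i _ _.
    by rewrite lee_fin.
  move: l0 le; case: (\sum_(0 <= i <oo) (a i)%:E)%E => // r _ le.
  exfalso.
  have [n] := aM (r + 1); move: (le n); rewrite lee_fin => {le}; lra.
Qed.

(** By the inequality of arithmetic and geometric means, the argument of the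
logarithm is at least one. *)
Lemma ln_mean_ratio_ge0 (R : realType) (s s' : R) : 0 < s -> 0 < s' ->
  0 <= ln ((s ^+ 2 + s' ^+ 2) / (2 * s * s')).
Proof.
move=> s0 s'0; rewrite ln_ge0// ler_pdivlMr ?mulr_gt0// mul1r.
by have := sqr_ge0 (s - s'); lra.
Qed.

Lemma cumulative_exponent_unbounded (R : realType) (m s m' s' : nat -> R) :
  (forall i, 0 < s i) -> (forall i, 0 < s' i) ->
  (forall M, exists n, M <= cumulative_exponent m s m' s' n) <->
  (\sum_(0 <= i <oo)
     ((m i - m' i) ^+ 2 / (s i ^+ 2 + s' i ^+ 2))%:E = +oo)%E \/
  (\sum_(0 <= i <oo)
     (ln ((s i ^+ 2 + s' i ^+ 2) / (2 * s i * s' i)))%:E = +oo)%E.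
Proof.
move=> s0 s'0.
set a := fun i => (m i - m' i) ^+ 2 / (s i ^+ 2 + s' i ^+ 2).
set b := fun i => ln ((s i ^+ 2 + s' i ^+ 2) / (2 * s i * s' i)).
have a0 i : 0 <= a i by rewrite divr_ge0 ?sqr_ge0// addr_ge0 ?sqr_ge0.
have b0 i : 0 <= b i by exact: ln_mean_ratio_ge0.
have SE n : cumulative_exponent m s m' s' n =
    (\sum_(i < n) a i) / 4 + (\sum_(i < n) b i) / 2.
  by rewrite !mulr_suml -big_split.
have Sa0 n : 0 <= \sum_(i < n) a i by exact: sumr_ge0.
have Sb0 n : 0 <= \sum_(i < n) b i by exact: sumr_ge0.
rewrite (nneseries_unbounded a0) (nneseries_unbounded b0); split.
- move=> unbounded; have [|na] := pselect (forall M, exists n,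
    M <= \sum_(i < n) a i); [by left|right => M].
  have [A nA] : exists A, forall n, \sum_(i < n) a i < A.
    have /existsNP[A /forallNP nA] := na; exists A => n.
    by rewrite ltNge; exact/negP.
  have [n] := unbounded (A / 4 + M / 2); rewrite SE => Mn; exists n.
  by have := nA n; lra.
- move=> [aM|bM] M.
  + have [n Mn] := aM (4 * M); exists n; rewrite SE.
    by have := Sb0 n; lra.
  + have [n Mn] := bM (2 * M); exists n; rewrite SE.
    by have := Sa0 n; lra.
Qed.

(** * Recovering the label *)

Lemma negligible_fin_bigcup d (T : measurableType d) (R : realType)
    (mu : {measure set T -> \bar R}) I (D : set I) (F : I -> set T) :
  finite_set D -> (forall i, D i -> mu.-negligible (F i)) ->
  mu.-negligible (\bigcup_(i in D) F i).
Proof.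
move=> finD; apply: (fin_bigcup_closedP _).1 => //.
by split; [exact: negligible_set0|move=> A B; exact: negligibleU].
Qed.

(** Let [D (z, v)] be null for [K z] and conull for [K v].  The sets [B z] of
points that lie in every [D (v, z)] and outside every [D (z, v)] are pairwise
disjoint, and [B z] is conull for [K z]; the classifier maps [B z] to [z]. *)
Lemma singular_family_classifier d dE (S : measurableType d)
    (E : measurableType dE) (R : realType) (V : set E)
    (K : E -> probability S R) :
  finite_set [set: E] ->
  (forall z v, V z -> V v -> v <> z ->
     exists A, [/\ measurable A, K z A = 0%E & K v (~` A) = 0%E]) ->
  exists2 f : S -> E, measurable_fun setT f &
    forall z, V z -> K z (~` (f @^-1` [set z])) = 0%E.
Proof.
move=> finE singular.
have finS (Y : set E) : finite_set Y by exact: sub_finite_set finE.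
(* For the pairs that need no separation, [set0] is an arbitrary value. *)
have sets zv : exists A, measurable A /\
    (V zv.1 -> V zv.2 -> zv.2 <> zv.1 ->
     K zv.1 A = 0%E /\ K zv.2 (~` A) = 0%E).
  case: zv => z v /=.
  have [[Vz [Vv vz]]|H] := pselect (V z /\ V v /\ v <> z).
    by have [A [mA A0 A1]] := singular _ _ Vz Vv vz; exists A.
  by exists set0; split => // Vz Vv vz; exfalso; exact: H.
have [D DP] := choice sets.
have mD zv : measurable (D zv) by have [] := DP zv.
pose B z := \bigcap_(v in V `\ z) (D (v, z) `\` D (z, v)).
have mB z : measurable (B z).
  by apply: fin_bigcap_measurable => // v _; exact: measurableD.
have BK z : V z -> (K z).-negligible (~` B z).
  move=> Vz; rewrite /B setC_bigcap.
  apply: negligible_fin_bigcup => // v [Vv vz].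
  rewrite setDE setCI setCK; apply: negligibleU; apply/negligibleP => //.
  - exact: measurableC.
  - by have [_ []] := DP (v, z) => //= zv; apply: vz.
  - by have [_ []] := DP (z, v).
have B_inj z v x : V z -> V v -> B z x -> B v x -> v = z.
  move=> Vz Vv Bz Bv; have [//|vz] := pselect (v = z); exfalso.
  have [_] := Bv z (conj Vz (fun zv => vz (esym zv))).
  by have [+ _] := Bz v (conj Vv vz).
pose f x := xget point [set z | V z /\ B z x].
have fB z x : V z -> B z x -> f x = z.
  by move=> Vz Bz; apply: xget_unique => // v [Vv Bv]; exact: B_inj Bv.
have fE y : f @^-1` [set y] =
    (if `[< V y >] then B y else set0) `|`
    (if `[< y = point >] then \bigcap_(z in V) ~` B z else set0).
  apply/seteqP; split=> x /=.
  - rewrite /f; case: xgetP => [z _ [Vz Bz] <-|NB <-].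
      by left; case: asboolP.
    by right; case: asboolP => // _ z Vz Bz; exact: (NB z).
  - move=> [|]; case: asboolP => //.
      by move=> Vy By; exact: fB.
    by move=> -> NB; apply: xgetPN => z [Vz]; exact: NB.
have mf1 y : measurable (f @^-1` [set y]).
  rewrite fE; apply: measurableU; case: ifP => // _.
  by apply: fin_bigcap_measurable => // z _; exact: measurableC.
exists f.
- move=> _ Y _; rewrite setTI.
  rewrite (_ : _ @^-1` _ = \bigcup_(y in Y) f @^-1` [set y]).
    exact: fin_bigcup_measurable.
  by apply/seteqP; split => x /= => [Yx|[y Yy ->]//]; exists (f x).
- move=> z Vz; apply: measure_negligible; first exact: measurableC.
  by apply: negligibleS (BK z Vz); apply: subsetC => x; exact: fB.
Qed.

(* Values z with P (Z = z) = 0 are excluded on the right-hand side: at such z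
   the law K z is arbitrary, and for E = {0, 1}, Z = 0 almost surely and
   K 0 = K 1 the map f = 0 exists although both series vanish. *)
Theorem corollary1 (R : realType) (d dE : measure_display)
  (Omega : measurableType d) (P : probability Omega R)
  (E : measurableType dE)
  (finE : finite_set [set: E]) (discreteE : forall A : set E, measurable A)
  (Z : {RV P >-> E}) (X : nat -> {RV P >-> R})
  (mu sigma : nat -> E -> R) (sigma_gt0 : forall i z, 0 < sigma i z)
  (K : E -> probability (Rseq R) R)
  (K_cond : is_conditional_distribution P
     ((fun w i => X i w) : Omega -> Rseq R) Z K)
  (K_prod : forall z, is_infinite_product
     (fun i => normal_prob (mu i z) (sigma i z)) (K z)) :
  (exists f : {mfun Rseq R >-> E},
     {ae P, forall w, Z w = f (fun i => X i w)})
  <->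
  (forall z v : E,
     (0 < P [set w | Z w = z])%E -> (0 < P [set w | Z w = v])%E -> v <> z ->
     (\sum_(0 <= i <oo)
        ((mu i z - mu i v) ^+ 2 / (sigma i z ^+ 2 + sigma i v ^+ 2))%:E
      = +oo)%E
     \/
     (\sum_(0 <= i <oo)
        (ln ((sigma i z ^+ 2 + sigma i v ^+ 2)
             / (2 * sigma i z * sigma i v)))%:E
      = +oo)%E).
Proof.
have mZ z : measurable [set w | Z w = z].
  exact: (measurable_funPTI Z (discreteE [set z])).
have mX : measurable_fun [set: Omega] ((fun w i => X i w) : Omega -> Rseq R).
  apply: (@measurability _ _ Omega (Rseq R) _ _ (coordinate_sets R)) => //.
  move=> _ [_ [i _ [B mB <-]] <-]; rewrite !setTI.
  exact: (measurable_funPTI (X i) mB).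
have conditional z (A : set (Rseq R)) : (0 < P [set w | Z w = z])%E ->
    measurable A ->
    P.-negligible [set w | A (fun i => X i w) /\ Z w = z] <-> K z A = 0%E.
  move=> Pz mA; have mAZ : measurable [set w | A (fun i => X i w) /\ Z w = z].
    apply: (measurableI _ _ _ (mZ z)); rewrite -[X in measurable X]setTI.
    exact: mX.
  have PE : (P [set w | A (fun i => X i w) /\ Z w = z] =
      K z A * P [set w | Z w = z])%E by exact: K_cond.
  split=> [neg|KA0].
    have := measure_negligible mAZ neg; rewrite [LHS]PE => /eqP.
    by rewrite mule_eq0 => /orP[/eqP //|]; rewrite gt_eqF.
  by apply/negligibleP => //; rewrite [LHS]PE KA0 mul0e.
split=> [[f fP] z v Pz Pv vz|diverge].
- apply/(cumulative_exponent_unbounded (mu^~ z) (mu^~ v)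
    (fun i => sigma_gt0 i z) (fun i => sigma_gt0 i v)).
  apply: contrapT => /existsNP[M /forallNP SM].
  have mf (Y : set E) : measurable (f @^-1` Y).
    exact: (measurable_funPTI f (discreteE Y)).
  apply: (@not_mutually_singular _ (mu^~ z) (sigma^~ z) (mu^~ v) (sigma^~ v)
    (K z) (K v) M (f @^-1` [set v])) => //.
  + by move=> n; rewrite leNgt; apply/negP => /ltW; exact: SM.
  + apply/conditional => //; apply: negligibleS fP => w /= [fv Zz] Zf.
    by apply: vz; rewrite -fv -Zf.
  + apply/conditional => //; first exact: measurableC.
    by apply: negligibleS fP => w /= [fv Zv] Zf; apply: fv; rewrite -Zf.
- have singular z v : (0 < P [set w | Z w = z])%E ->
      (0 < P [set w | Z w = v])%E -> v <> z ->
      exists A, [/\ measurable A, K z A = 0%E & K v (~` A) = 0%E].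
    move=> Pz Pv vz.
    apply: (@mutually_singular _ (mu^~ z) (sigma^~ z) (mu^~ v) (sigma^~ v));
      rewrite //.
    by apply/cumulative_exponent_unbounded => //; exact: diverge.
  have [f mf fP] := singular_family_classifier finE singular.
  pose F : {mfun Rseq R >-> E} :=
    HB.pack f (isMeasurableFun.Build _ _ _ _ f mf).
  exists F.
  have bad : P.-negligible (\bigcup_(z in [set: E])
      [set w | (~` (f @^-1` [set z])) (fun i => X i w) /\ Z w = z]).
    apply: negligible_fin_bigcup => // z _.
    have [Pz|] := boolP (0 < P [set w | Z w = z])%E.
      apply/conditional => //; last exact: fP.
      by apply: measurableC; exact: (measurable_funPTI F (discreteE [set z])).
    (* A label of probability zero does not affect the almost sure equality. *)
    rewrite -leNgt => Pz; apply: (@negligibleS _ _ _ _ [set w | Z w = z]).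
      by move=> w [].
    by apply/negligibleP => //; apply/eqP; rewrite eq_le Pz measure_ge0.
  apply: negligibleS bad => w /= Zf; exists (Z w) => //.
  by split => // fZ; apply: Zf; rewrite /= fZ.
Qed.
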